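(* Let $G$ be a finite simple graph such that $I(G)^s$ has linear quotients for some integer $s\ge 1$, and fix a vertex $x$ of $G$. Then $I(G^{[x]})^s$ has linear quotients if and only if $G^{[x]}$ is gapfree.
   Context: For a finite simple graph $G$ on vertices $1,\ldots,n$, its edge ideal $I(G)\subseteq K[x_1,\ldots,x_n]$ ($K$ a field) is generated by the monomials $x_ix_j$ for the edges $\{i,j\}$ of $G$. A monomial ideal generated in a single degree has linear quotients if its minimal monomial generators can be ordered $u_1>\cdots>u_r$ so that each colon ideal $(u_1,\ldots,u_i):u_{i+1}$, $1\le i<r$, is generated by a subset of the variables. A graph is gapfree if for any two edges $e,e'$ with $e\cap e'=\emptyset$ there is an edge $f$ with $e\cap f\neq\emptyset$ and $e'\cap f\neq\emptyset$. The expansion $G^{[x]}$ of $G$ at $x$ is obtained by adding a new vertex $y$ with edge set $E(G)\cup\{yb : xb\in E(G)\}\cup\{xy\}$ (with a new variable for $y$). *)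

(* Defs.v *)
From mathcomp Require Import all_boot all_order all_algebra.
From mathcomp Require Import mpoly.
Set Implicit Arguments. Unset Strict Implicit. Unset Printing Implicit Defensive.
Import GRing.Theory.
Local Open Scope ring_scope.

Definition in_ideal (K : fieldType) (n : nat) (gs : seq {mpoly K[n]})
    (f : {mpoly K[n]}) : Prop :=
  exists c : 'I_(size gs) -> {mpoly K[n]}, f = \sum_(i < size gs) c i * gs`_i.

Definition simple_graph (n : nat) (e : rel 'I_n) : Prop :=
  ssrbool.symmetric e /\ ssrbool.irreflexive e.

Definition edge_gens (K : fieldType) (n : nat) (e : rel 'I_n) : seq {mpoly K[n]} :=
  [seq 'X_ij.1 * 'X_ij.2 | ij <- [seq (i, j) | i <- enum 'I_n, j <- enum 'I_n]
                         & e ij.1 ij.2 && (ij.1 < ij.2)%N].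

Fixpoint pow_gens (K : fieldType) (n : nat) (gs : seq {mpoly K[n]}) (s : nat)
    : seq {mpoly K[n]} :=
  match s with
  | 0 => [:: 1]
  | s'.+1 => [seq a * b | a <- gs, b <- pow_gens gs s']
  end.

Definition min_mon_gen (K : fieldType) (n : nat) (I : {mpoly K[n]} -> Prop)
    (m : 'X_{1..n}) : Prop :=
  I 'X_[m] /\ forall m' : 'X_{1..n}, lem m' m -> m' != m -> ~ I 'X_[m'].

(* The monomial ideal generated by gs has linear quotients: its minimal monomial
   generators can be ordered u_1, ..., u_r so that each colon ideal
   (u_1,...,u_i) : u_{i+1} (1 <= i < r) is generated by a subset of the variables. *)
Definition linear_quotients (K : fieldType) (n : nat) (gs : seq {mpoly K[n]}) : Prop :=
  exists us : seq 'X_{1..n},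
    [/\ uniq us,
        (forall m, m \in us <-> min_mon_gen (in_ideal gs) m) &
        forall i, (0 < i < size us)%N ->
          exists V : seq 'I_n,
            forall f : {mpoly K[n]},
              in_ideal [seq 'X_[u] | u <- take i us] (f * 'X_[nth 0%MM us i])
              <-> in_ideal [seq 'X_v | v <- V] f].

Definition gapfree (n : nat) (e : rel 'I_n) : Prop :=
  forall a b c d : 'I_n, e a b -> e c d ->
    [&& a != c, a != d, b != c & b != d] ->
    exists u v : 'I_n, [/\ e u v,
                         (u == a) || (u == b) || (v == a) || (v == b) &
                         (u == c) || (u == d) || (v == c) || (v == d)].

(* Expansion G^[x]: vertex set 'I_n.+1, the new vertex y is ord_max, the old vertex
   j : 'I_n is the vertex with the same index (widen_ord).  Edges:
   E(G) U {y b : x b in E(G)} U {x y}. *)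
Definition expansion (n : nat) (e : rel 'I_n) (x : 'I_n) : rel 'I_n.+1 :=
  fun a b =>
    match unlift ord_max a, unlift ord_max b with
    | Some a', Some b' => e a' b'
    | None, Some b' => e x b' || (b' == x)
    | Some a', None => e x a' || (a' == x)
    | None, None => false
    end.

(* Main.v *)
(* The edges of G^[x] other than xy are those of G with x possibly replaced by y, and
   G^[x] is gapfree only if every edge of G meets N = N(x).  By [x y p q = (x p) (y q)],
   a generator u of I(G^[x])^s then satisfies one of:
   - u(y := x) is a generator of I(G)^s;
   - [u = (xy)^j u'] with j > 0 and u' a product of s - j edges having exactly one end
     in N, so that j is determined by the N-degree s - j of u.
   Generators of the first kind come first, ordered as their images in I(G)^s; those of
   the second kind follow by decreasing N-degree; ties are broken lexicographically.
   For u of the second kind every variable of N lies in the colon ideal (replace a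
   factor x by it), and the generators with the same N-part as u form, up to a common
   factor, a transversal polymatroid, which has linear quotients by exchange.
   Conversely, if ab and cd form a gap, then the generators of I(G)^s supported on
   {a, b, c, d} are the [(ab)^i (cd)^(s-i)], and no two of them differ by exchanging a
   single variable. *)
Require Import Defs.
From mathcomp Require Import all_boot all_order all_algebra.
From mathcomp Require Import mpoly.
From mathcomp Require Import perm zify.

Set Implicit Arguments. Unset Strict Implicit. Unset Printing Implicit Defensive.

(** * Monomial ideals, their colon ideals and linear quotients *)

Lemma lem_mdeg_eq (n : nat) (m m' : 'X_{1..n}) :
  (m <= m')%MM -> mdeg m = mdeg m' -> m = m'.
Proof.
move=> le_m eq_d; have := submK le_m; move: (m' - m)%MM => d Ed.
move: eq_d; rewrite -Ed mdegD => /eqP; rewrite -[X in X == _]add0n eqn_add2r.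
by rewrite eq_sym mdeg_eq0 => /eqP->; rewrite add0m.
Qed.

Section MonomialIdeals.

Import GRing.Theory.
Local Open Scope ring_scope.

Variables (K : fieldType) (n : nat).
Implicit Types (gs : seq {mpoly K[n]}) (f : {mpoly K[n]}).
Implicit Types (m u : 'X_{1..n}) (us ms : seq 'X_{1..n}).

Definition mons us : seq {mpoly K[n]} := [seq 'X_[u] | u <- us].

Lemma in_ideal0 gs : in_ideal gs 0.
Proof. by exists (fun=> 0); rewrite big1 // => i _; rewrite mul0r. Qed.

Lemma in_idealD gs f g : in_ideal gs f -> in_ideal gs g -> in_ideal gs (f + g).
Proof.
move=> [c ->] [d ->]; exists (fun i => c i + d i).
by rewrite -big_split; apply: eq_bigr => i _; rewrite mulrDl.
Qed.

Lemma in_idealMl gs f g : in_ideal gs g -> in_ideal gs (f * g).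
Proof.
move=> [c ->]; exists (fun i => f * c i).
by rewrite big_distrr; apply: eq_bigr => i _ /=; rewrite mulrA.
Qed.

Lemma mem_in_ideal gs g : g \in gs -> in_ideal gs g.
Proof.
move=> g_gs; have lt_i : (index g gs < size gs)%N by rewrite index_mem.
exists (fun i => (i == Ordinal lt_i)%:R).
rewrite (bigD1 (Ordinal lt_i)) //= eqxx mul1r nth_index // big1 ?addr0 //.
by move=> i /negbTE->; rewrite mul0r.
Qed.

Lemma in_ideal_mons us f :
  in_ideal (mons us) f <->
  forall m, m \in msupp f -> exists2 u, u \in us & (u <= m)%MM.
Proof.
split=> [[c ->] m /msupp_sum_le | supp_f].
  case/flatten_mapP=> i _; have lt_i : (i < size us)%N.
    by apply: leq_trans (ltn_ord i) _; rewrite size_map.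
  rewrite (nth_map 0%MM) // (perm_mem (msuppMX _ _)).
  case/mapP=> m' _ ->; exists (nth 0%MM us i); first exact: mem_nth.
  exact: lem_addr.
rewrite [f]mpolyE big_seq; elim/big_ind: _ => [||m /supp_f[u us_u le_um]].
- exact: in_ideal0.
- by move=> *; apply: in_idealD.
- rewrite -(submK le_um) mpolyXD -mul_mpolyC mulrA; apply: in_idealMl.
  by apply: mem_in_ideal; apply: map_f.
Qed.

Lemma in_ideal_monsX us m :
  in_ideal (mons us) 'X_[m] <-> exists2 u, u \in us & (u <= m)%MM.
Proof.
split=> [/in_ideal_mons | exu]; first by apply; rewrite msuppX inE.
by apply/in_ideal_mons => m'; rewrite msuppX inE => /eqP->.
Qed.

(** Within one degree divisibility is equality, so every listed monomial is already minimal. *)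
Lemma min_mon_gen_mons ms d m :
  {in ms, forall u, mdeg u = d} ->
  min_mon_gen (in_ideal (mons ms)) m <-> m \in ms.
Proof.
move=> deg_ms; split=> [[/in_ideal_monsX[u ms_u le_um] minm] | ms_m].
  case: (eqVneq u m) => [<- // | neq_um]; case: (minm u) => //.
  by apply/in_ideal_monsX; exists u => //; apply: lepm_refl.
split=> [|m' le_m' neq_m' /in_ideal_monsX[u ms_u le_um']].
  by apply/in_ideal_monsX; exists m => //; apply: lepm_refl.
have Eu : u = m by apply: lem_mdeg_eq; [apply: lepm_trans le_m' | rewrite !deg_ms].
case/eqP: neq_m'; apply: lem_mdeg_eq => //; apply/eqP.
rewrite eqn_leq; apply/andP; split; rewrite !mdegE; apply: leq_sum => i _.
  exact: (mnm_lepP le_m').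
by rewrite -Eu; apply: (mnm_lepP le_um').
Qed.

(** The colon ideal is generated by the quotients [u' / gcd(u, u')]. It is generated by variables
    exactly when each quotient is divisible by a variable [z] such that [z u] lies in the ideal. *)
Definition colon_step us u :=
  forall u', u' \in us -> exists z, exists2 u'', u'' \in us &
    (u z < u' z)%N /\ (u'' <= u + U_(z))%MM.

Lemma colon_variablesP us u :
  (exists V : seq 'I_n, forall f : {mpoly K[n]},
     in_ideal (mons us) (f * 'X_[u]) <-> in_ideal [seq 'X_v | v <- V] f)
  <-> colon_step us u.
Proof.
have Xmap V : [seq 'X_v | v <- V] = mons [seq U_(v)%MM | v <- V].
  by rewrite /mons -map_comp.
split=> [[V colV] u' us_u' | step].
  (* Subtraction is truncated, so [u' - u] is the exponent of [u' / gcd(u, u')]. *)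
  have: in_ideal [seq 'X_v | v <- V] ('X_[u' - u] : {mpoly K[n]}).
    apply/colV; rewrite -mpolyXD; apply/in_ideal_monsX; exists u' => //.
    by apply/mnm_lepP => i; rewrite mnmDE mnmBE; lia.
  rewrite Xmap => /in_ideal_monsX[_ /mapP[z V_z ->]]; rewrite lep1mP mnmBE => ltz.
  have: in_ideal (mons us) ('X_z * 'X_[u]).
    by apply/colV/mem_in_ideal/map_f.
  rewrite -mpolyXD => /in_ideal_monsX[u'' us_u'' le_u''].
  by exists z, u'' => //; rewrite addmC; split=> //; lia.
(* All variables lying in the colon ideal are taken. *)
exists [seq z <- enum 'I_n | has (fun u'' => lem u'' (u + U_(z))%MM) us] => f.
have Vz z : (z \in [seq z <- enum 'I_n | has (fun u'' => lem u'' (u + U_(z))%MM) us])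
            = has (fun u'' => lem u'' (u + U_(z))%MM) us.
  by rewrite mem_filter mem_enum andbT.
rewrite Xmap !in_ideal_mons; split=> [sup m f_m | sup m].
  have [|u' us_u' le_u'] := sup (u + m)%MM.
    by rewrite (perm_mem (msuppMX _ _)) map_f.
  have [z [u'' us_u'' [lt_z le_u'']]] := step u' us_u'.
  exists U_(z)%MM; first by apply: map_f; rewrite Vz; apply/hasP; exists u''.
  by rewrite lep1mP; move/mnm_lepP/(_ z): le_u'; rewrite mnmDE; lia.
rewrite (perm_mem (msuppMX _ _)) => /mapP[m' f_m' ->].
have [w /mapP[z V_z Ew]] := sup m' f_m'; move: V_z; rewrite Ew Vz => /hasP[u'' us_u'' le_u''].
rewrite lep1mP => m'z; exists u'' => //; apply: lepm_trans le_u'' _.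
apply/mnm_lepP => i; rewrite !mnmDE mnm1E leq_add2l.
by case: eqP => // <-; lia.
Qed.

(* Linear quotients when the generators [ms] are ordered by [lt], earlier ones being
   smaller. *)
Definition lq_rel (ms : seq 'X_{1..n}) (lt : rel 'X_{1..n}) :=
  forall u u', u \in ms -> u' \in ms -> lt u' u ->
  exists z, exists2 u'', u'' \in ms &
    [/\ (u z < u' z)%N, lt u'' u & (u'' <= u + U_(z))%MM].

Lemma lq_rel_of_linear_quotients ms d :
  {in ms, forall u, mdeg u = d} -> linear_quotients (mons ms) ->
  exists2 us, us =i ms & lq_rel us (relpre (index^~ us) ltn).
Proof.
move=> deg_ms [us [uniq_us us_min us_col]]; exists us => [m|].
  by apply/idP/idP => [/us_min/(min_mon_gen_mons _ deg_ms)|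
    /(min_mon_gen_mons _ deg_ms)/us_min].
move=> u u' us_u us_u' /= lt_u'u.
have u_i : (0 < index u us < size us)%N by rewrite index_mem us_u andbT; lia.
have /colon_variablesP step := us_col _ u_i; rewrite nth_index // in step.
have [|z [u'' us_u'' [lt_z le_u'']]] := step u'; first by rewrite in_take.
have us_u2 := mem_take us_u''.
by exists z, u'' => //; split=> //; rewrite in_take in us_u''.
Qed.

(** The list is [ms] without repetitions, sorted by the reflexive closure of [lt]; since [lt] is a
    strict total order, positions in it agree with [lt]. *)
Lemma linear_quotients_of_lq_rel ms d (lt : rel 'X_{1..n}) :
  {in ms, forall u, mdeg u = d} -> irreflexive lt -> transitive lt ->
  (forall u u', u != u' -> lt u u' || lt u' u) -> lq_rel ms lt ->
  linear_quotients (mons ms).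
Proof.
move=> deg_ms irr tr tot lq.
pose le u u' := (u == u') || lt u u'.
have le_tr : transitive le.
  move=> v u w /orP[/eqP->|uv] // /orP[/eqP<-|vw]; first by rewrite /le uv orbT.
  by rewrite /le (tr _ _ _ uv vw) orbT.
have le_tot : total le.
  by move=> u v; rewrite /le eq_sym; case: eqVneq => //= /tot; rewrite orbC.
pose us := sort le (undup ms).
have us_ms : us =i ms by move=> u; rewrite mem_sort mem_undup.
have uniq_us : uniq us by rewrite sort_uniq undup_uniq.
have sorted_us : sorted le us by apply: sort_sorted.
have ltP u v : u \in us -> v \in us -> (index u us < index v us)%N = lt u v.
  move=> us_u us_v.
  have lt_imp a b : a \in us -> b \in us -> (index a us < index b us)%N -> lt a b.
    move=> us_a us_b lt_ab; have /orP[/eqP E|//] : le a b.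
      have := sorted_leq_nth le_tr _ 0%MM sorted_us.
      move/(_ _ (index a us) (index b us)); rewrite !inE !index_mem !nth_index //.
      by apply=> //; [move=> w; rewrite /le eqxx | apply: ltnW].
    by rewrite E ltnn in lt_ab.
  apply/idP/idP => [|lt_uv]; first exact: lt_imp.
  rewrite ltnNge leq_eqVlt; apply/negP => /orP[/eqP Ei|/(lt_imp _ _ us_v us_u) lt_vu].
    move: lt_uv; rewrite -[u](nth_index 0%MM us_u) -Ei nth_index //.
    by rewrite irr.
  by have := tr _ _ _ lt_uv lt_vu; rewrite irr.
exists us; split=> // [m | i /andP[i_gt0 lt_i]].
  by rewrite us_ms (min_mon_gen_mons _ deg_ms).
apply/colon_variablesP => u' us_u'; set u := nth _ us i.
have us_u : u \in us by rewrite mem_nth.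
have Eu : index u us = i by rewrite index_uniq.
have us_u1 := mem_take us_u'.
have lt_u' : lt u' u by rewrite -ltP // Eu -in_take.
have [||z [u'' ms_u'' [lt_z lt_u'' le_u'']]] := lq u u' _ _ lt_u'; rewrite -?us_ms //.
rewrite -us_ms in ms_u''.
by exists z, u'' => //; rewrite in_take // -Eu ltP.
Qed.

End MonomialIdeals.

(** * Products of edges as exponent vectors *)

Section EdgeProducts.

Variable n : nat.
Implicit Types (e : rel 'I_n) (u m : 'X_{1..n}) (P : pred 'I_n).

Definition edge_mons e : seq 'X_{1..n} :=
  [seq (U_(ij.1) + U_(ij.2))%MM | ij <- [seq (i, j) | i <- enum 'I_n, j <- enum 'I_n]
                                & e ij.1 ij.2 && (ij.1 < ij.2)].

Fixpoint pow_mons (ms : seq 'X_{1..n}) s : seq 'X_{1..n} :=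
  if s is s'.+1 then [seq (a + b)%MM | a <- ms, b <- pow_mons ms s'] else [:: 0%MM].

Lemma pow_gens_edge_gens (K : fieldType) e s :
  pow_gens (edge_gens K e) s = mons K (pow_mons (edge_mons e) s).
Proof.
elim: s => [|s IHs] /=; first by rewrite /mons /= mpolyX0.
rewrite IHs /mons map_allpairs /edge_gens /edge_mons !allpairs_mapl allpairs_mapr.
by apply: eq_allpairs => ij m /=; rewrite !mpolyXD.
Qed.

(** The relation is arbitrary so that oriented edges are covered too: below, an orientation records
    which end lies in N(x). *)
Inductive edge_prod e : nat -> 'X_{1..n} -> Prop :=
| EdgeProd0 : edge_prod e 0 0%MM
| EdgeProdS s i j m : e i j -> edge_prod e s m ->
    edge_prod e s.+1 (U_(i) + U_(j) + m)%MM.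

Lemma mem_pow_mons e s m : simple_graph e ->
  m \in pow_mons (edge_mons e) s <-> edge_prod e s m.
Proof.
move=> [sym_e irr_e]; split=> [|].
  elim: s m => [|s IHs] m /=; first by rewrite inE => /eqP->; constructor.
  case/allpairsP=> [[a b]] /= [/mapP[[i j]] + -> /IHs ep_b ->].
  by rewrite mem_filter /= => /andP[/andP[e_ij _] _] /=; constructor.
elim=> [|{m}{}s i j m e_ij _ IHm] /=; first by rewrite inE.
wlog lt_ij : i j e_ij / i < j => [lem|].
  case: (ltngtP i j) => [lt_ij|lt_ji|/val_inj Eij]; first exact: lem.
    by rewrite [(U_(i) + _)%MM]addmC; apply: lem; rewrite // sym_e.
  by rewrite Eij irr_e in e_ij.
apply: allpairs_f => //; apply/mapP; exists (i, j) => //.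
by rewrite mem_filter /= e_ij lt_ij; apply: allpairs_f; rewrite mem_enum.
Qed.

Lemma sub_edge_prod e e' s m :
  subrel e e' -> edge_prod e s m -> edge_prod e' s m.
Proof. by move=> sub_e; elim=> *; constructor=> //; apply: sub_e. Qed.

Lemma edge_prodD e s t m m' :
  edge_prod e s m -> edge_prod e t m' -> edge_prod e (s + t) (m + m')%MM.
Proof.
move=> ep_m ep_m'; elim: ep_m => [|{m}{}s i j m e_ij _ IH]; first by rewrite add0m.
by rewrite -addmA addSn; constructor.
Qed.

Lemma edge_prodMn e i j k : e i j -> edge_prod e k ((U_(i) + U_(j)) *+ k)%MM.
Proof.
by move=> e_ij; elim: k => [|k IHk]; [rewrite mulm0n|rewrite mulmS]; constructor.
Qed.

Definition pdeg P u := (\sum_(a | P a) u a)%N.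

Lemma pdegD P u u' : pdeg P (u + u')%MM = (pdeg P u + pdeg P u')%N.
Proof. by rewrite -big_split; apply: eq_bigr => i _; rewrite mnmDE. Qed.

Lemma pdeg0 P : pdeg P 0%MM = 0.
Proof. by rewrite /pdeg big1 // => i _; rewrite mnm0E. Qed.

Lemma pdeg1 P a : pdeg P U_(a)%MM = P a.
Proof.
rewrite /pdeg; case: (boolP (P a)) => Pa.
  rewrite (bigD1 a) //= mnm1E eqxx big1 // => i /andP[_ ne_i].
  by rewrite mnm1E eq_sym (negbTE ne_i).
by rewrite big1 // => i Pi; rewrite mnm1E; case: eqP => // Ea; rewrite Ea Pi in Pa.
Qed.

Lemma pdegMn P u k : pdeg P (u *+ k)%MM = (pdeg P u * k)%N.
Proof. by elim: k => [|k IH]; rewrite ?mulm0n ?pdeg0 ?muln0 // mulmS pdegD IH mulnS. Qed.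

Lemma leq_pdeg P u u' : (forall a, P a -> u a <= u' a) -> pdeg P u <= pdeg P u'.
Proof. exact: leq_sum. Qed.

Lemma pdeg_lt_ex P u u' : pdeg P u < pdeg P u' -> exists2 a, P a & u a < u' a.
Proof.
move=> lt_u; case: (pickP [pred a | P a & u a < u' a]) => [a /andP[]|no]; first by exists a.
move: lt_u; rewrite ltnNge leq_pdeg // => a Pa; have := no a; rewrite /= Pa /=; lia.
Qed.

Lemma mdeg_edge_prod e s m : edge_prod e s m -> mdeg m = s.*2.
Proof. by elim=> [|{m}{}s i j m _ _ IH]; rewrite ?mdeg0 // !mdegD !mdeg1 IH; lia. Qed.

Lemma pdeg_edge_prod_ge P e s m :
  (forall i j, e i j -> P i || P j) -> edge_prod e s m -> s <= pdeg P m.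
Proof.
by move=> cov; elim=> [|{m}{}s i j m /cov Pij _ IH] //; rewrite !pdegD !pdeg1; lia.
Qed.

Lemma edge_prod_sumP e s m :
  edge_prod e s m <-> exists p q : 'I_s -> 'I_n,
    (forall k, e (p k) (q k)) /\ m = (\sum_k (U_(p k) + U_(q k)))%MM.
Proof.
split=> [|[p [q [e_pq ->]]]].
  elim=> [|{m}{}s i j m e_ij _ [p [q [e_pq ->]]]].
    (* [widen_ord] gives a function out of the empty ['I_0] without naming an element of ['I_n]. *)
    by exists (fun k => widen_ord (leq0n n) k), (fun k => widen_ord (leq0n n) k);
       split=> [[]|]; rewrite ?big_ord0.
  exists (fun k => oapp p i (unlift ord0 k)), (fun k => oapp q j (unlift ord0 k)).
  split=> [k|]; first by case: (unlift ord0 k) => [k'|] /=.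
  by rewrite big_ord_recl unlift_none; congr (_ + _)%MM; apply: eq_bigr => k _; rewrite liftK.
elim: s p q e_pq => [|s IHs] p q e_pq; first by rewrite big_ord0; constructor.
by rewrite big_ord_recl; constructor=> //; apply: IHs => k; apply: e_pq.
Qed.

(* Symmetric exchange for transversal polymatroids, along an alternating path
   of reassignments. *)
Lemma transversal_exchange (I : finType) (R : I -> pred 'I_n) (f g : I -> 'I_n) i :
  (forall k, R k (f k)) -> (forall k, R k (g k)) ->
  (\sum_k U_(f k))%MM i < (\sum_k U_(g k))%MM i ->
  exists j, exists2 h : I -> 'I_n, forall k, R k (h k) &
    (\sum_k U_(g k))%MM j < (\sum_k U_(f k))%MM j /\
    (\sum_k U_(h k) + U_(j) = \sum_k U_(f k) + U_(i))%MM.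
Proof.
(* Induction on the number of positions where [f] and [g] choose differently. *)
move=> Rf Rg; have [c] := ubnP #|[pred k | f k != g k]|.
elim: c f i Rf => // c IHc f i Rf le_c lt_i.
have [p gp fp] : exists2 p, g p = i & f p != i.
  case: (pickP [pred p | (g p == i) && (f p != i)]) => [p /andP[/eqP]|no]; first by exists p.
  move: lt_i; rewrite ltnNge !mnm_sumE leq_sum // => k _.
  by have := no k; rewrite !mnm1E /=; case: eqP; case: eqP.
pose f1 k := if k == p then i else f k.
have Ef1 : (\sum_k U_(f1 k) + U_(f p) = \sum_k U_(f k) + U_(i))%MM.
  rewrite (bigD1 p) //= [in RHS](bigD1 p) //= {1}/f1 eqxx.
  have -> : (\sum_(k | k != p) U_(f1 k) = \sum_(k | k != p) U_(f k))%MM.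
    by apply: eq_bigr => k /negbTE ne_k; rewrite /f1 ne_k.
  by apply/mnmP=> k; rewrite !mnmDE; lia.
have Rf1 k : R k (f1 k) by rewrite /f1; case: eqP => // ->; rewrite -gp.
(* Reassigning [p] to [i] gives up one [f p]. If [f] has more of it than [g], the exchange is done;
   otherwise [f1] is short of [f p], and the recursion repairs that. *)
have [lt_j|le_j] := ltnP ((\sum_k U_(g k))%MM (f p)) ((\sum_k U_(f k))%MM (f p)).
  by exists (f p); exists f1.
have Ef1' a : ((\sum_k U_(f1 k))%MM a + (f p == a) = (\sum_k U_(f k))%MM a + (i == a))%N.
  by rewrite -!mnm1E -!mnmDE Ef1.
have [||j [h Rh [lt_j Eh]]] := IHc f1 (f p) Rf1.
- apply: leq_trans (ltnSE le_c); apply: proper_card; apply/properP; split.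
    by apply/subsetP => k; rewrite !inE /f1; case: (eqVneq k p) => // ->; rewrite gp eqxx.
  by exists p; rewrite !inE gp ?fp // /f1 eqxx eqxx.
- by have := Ef1' (f p); rewrite eqxx eq_sym (negbTE fp); lia.
(* The [j] found for [f1] serves for [f]: only [i] is more frequent in [f1], and [j = i] is
   impossible because [g] has more of [i] than [f]. *)
exists j; exists h => //; rewrite Eh Ef1; split=> //.
have := Ef1' j; case: (eqVneq i j) => [Ej|_]; last lia.
by rewrite -Ej (negbTE fp) in lt_j *; lia.
Qed.

Lemma sum_mnm1_perm t (p p' : 'I_t -> 'I_n) :
  (\sum_k U_(p k) = \sum_k U_(p' k))%MM -> exists s : 'S_t, forall k, p' (s k) = p k.
Proof.
move=> Ep; have Ecnt (r : 'I_t -> 'I_n) a :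
    count_mem a [tuple r k | k < t] = (\sum_k U_(r k))%MM a.
  rewrite mnm_sumE -sum1_count big_map big_mkcond big_enum /=.
  by apply: eq_bigr => k _; rewrite mnm1E; case: eqP.
have /tuple_permP[s Es] : perm_eq [tuple p k | k < t] [tuple p' k | k < t].
  by apply/allP => a _; rewrite /= !Ecnt Ep.
exists s => k; have /(congr1 (fun l => nth (p k) l k)) := Es.
by rewrite -!tnth_nth !tnth_mktuple.
Qed.

End EdgeProducts.

(** * Linear quotients imply gapfree *)

Lemma gapfree_of_linear_quotients (K : fieldType) (n : nat) (e : rel 'I_n) (s : nat) :
  simple_graph e -> 0 < s -> linear_quotients (pow_gens (edge_gens K e) s) ->
  gapfree e.
Proof.
move=> se s_gt0; have [sym_e irr_e] := se; rewrite pow_gens_edge_gens => lq.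
have deg_ms : {in pow_mons (edge_mons e) s, forall u, mdeg u = s.*2}.
  by move=> u /(mem_pow_mons _ _ se)/mdeg_edge_prod.
have [us us_ms lq_us] := lq_rel_of_linear_quotients deg_ms lq.
move=> a b c d e_ab e_cd /and4P[ac ad bc bd].
(* Any edge between the two pairs settles the claim; afterwards there is none, and a contradiction
   is sought. *)
have [e_ac|n_ac] := boolP (e a c); first by exists a, c; rewrite !eqxx ?orbT.
have [e_ad|n_ad] := boolP (e a d); first by exists a, d; rewrite !eqxx ?orbT.
have [e_bc|n_bc] := boolP (e b c); first by exists b, c; rewrite !eqxx ?orbT.
have [e_bd|n_bd] := boolP (e b d); first by exists b, d; rewrite !eqxx ?orbT.
have ab : a != b by apply: contraTneq e_ab => ->; rewrite irr_e.
have cd : c != d by apply: contraTneq e_cd => ->; rewrite irr_e.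
pose W := [:: a; b; c; d].
have no_cross := (negbTE n_ac, negbTE n_ad, negbTE n_bc, negbTE n_bd, irr_e).
have dist := (negbTE ab, negbTE ac, negbTE ad, negbTE bc, negbTE bd, negbTE cd, eqxx).
have neq_sym (i j : 'I_n) : i != j -> (j == i) = false by rewrite eq_sym => /negbTE.
have dist' := (neq_sym _ _ ab, neq_sym _ _ ac, neq_sym _ _ ad, neq_sym _ _ bc,
  neq_sym _ _ bd, neq_sym _ _ cd).
have edgeW i j : e i j -> i \in W -> j \in W ->
    (i, j) \in [:: (a, b); (b, a); (c, d); (d, c)].
  rewrite !inE => e_ij /or4P[]/eqP Ei /or4P[]/eqP Ej; move: e_ij; rewrite Ei Ej;
    rewrite ?no_cross // ?xpair_eqE ?eqxx ?orbT // sym_e no_cross //.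
(* The only edges inside [W] are [ab] and [cd], so the two ends of each occur equally often. *)
have balanced m t : edge_prod e t m -> (forall z, m z != 0 -> z \in W) ->
    m a = m b /\ m c = m d.
  elim=> [|{}t i j {}m e_ij _ IHm] suppW; first by rewrite !mnm0E.
  have [z mz|Eab Ecd] := IHm.
    by apply: suppW; rewrite !mnmDE addn_eq0 negb_and mz orbT.
  have Wi : i \in W by apply: suppW; rewrite !mnmDE !mnm1E eqxx.
  have Wj : j \in W by apply: suppW; rewrite !mnmDE !mnm1E eqxx addn1.
  have := edgeW i j e_ij Wi Wj; rewrite !mnmDE !mnm1E Eab Ecd !inE !xpair_eqE.
  by case/or4P=> /andP[/eqP-> /eqP->]; rewrite !dist !dist'; split.
pose u1 := ((U_(a) + U_(b)) *+ s)%MM; pose u2 := ((U_(c) + U_(d)) *+ s)%MM.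
have suppP i j k z : ((U_(i) + U_(j)) *+ k)%MM z != 0 -> (z == i) || (z == j).
  by rewrite mulmnE mnmDE !mnm1E (eq_sym i) (eq_sym j); do 2!case: (z == _); rewrite ?mul0n.
have us_edge i j : e i j -> ((U_(i) + U_(j)) *+ s)%MM \in us.
  by move=> e_ij; rewrite us_ms; apply/(mem_pow_mons _ _ se)/edge_prodMn.
have us_prod u : u \in us -> edge_prod e s u by rewrite us_ms => /(mem_pow_mons _ _ se).
(* The exchange between two products supported on [W] stays supported on [W], where balance forbids
   changing a single variable. *)
have us_W u v : u \in us -> v \in us -> (forall z, u z != 0 -> z \in W) ->
    (forall z, v z != 0 -> z \in W) -> ~~ (index v us < index u us).
  move=> us_u us_v suppu suppv; apply/negP => lt_vu.
  have [z [u'' us_u'' [lt_z lt_u'' le_u'']]] := lq_us _ _ us_u us_v lt_vu.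
  have suppu'' w : u'' w != 0 -> w \in W.
    move=> u''w; have /mnm_lepP/(_ w) := le_u''; rewrite mnmDE mnm1E.
    case: (eqVneq z w) => [<- _|_].
      by apply: suppv; rewrite -lt0n; apply: leq_ltn_trans lt_z.
    by rewrite addn0 => le_w; apply: suppu; rewrite -lt0n; apply: leq_trans le_w; rewrite lt0n.
  have [Eu1 Eu2] := balanced u s (us_prod _ us_u) suppu.
  have [Eu3 Eu4] := balanced u'' s (us_prod _ us_u'') suppu''.
  suff Eu : u'' = u by rewrite /= Eu ltnn in lt_u''.
  apply: lem_mdeg_eq; last by rewrite !deg_ms -?us_ms.
  have le_w w : u'' w <= u w + (z == w) by have /mnm_lepP/(_ w) := le_u''; rewrite mnmDE mnm1E.
  have zW : z \in W by apply: suppv; rewrite -lt0n; apply: leq_ltn_trans lt_z.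
  apply/mnm_lepP => w; have := le_w w; case: (eqVneq z w) => [<-|_]; last by rewrite addn0.
  (* At [w = z], the exponent of the partner of [z] does not grow, and balance carries this bound
     over to [z]. *)
  have := le_w a; have := le_w b; have := le_w c; have := le_w d.
  rewrite -Eu1 -Eu2 -Eu3 -Eu4; move: zW; rewrite !inE.
  by case/or4P=> /eqP->; rewrite -?Eu1 -?Eu2 -?Eu3 -?Eu4 ?dist ?dist' ?addn0.
have W1 z : u1 z != 0 -> z \in W by move/suppP; rewrite !inE => /orP[]->; rewrite ?orbT.
have W2 z : u2 z != 0 -> z \in W by move/suppP; rewrite !inE => /orP[]->; rewrite ?orbT.
have us1 := us_edge _ _ e_ab; have us2 := us_edge _ _ e_cd.
(* Neither [(ab)^s] nor [(cd)^s] precedes the other, so they coincide; the exponent of [a] then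
   contradicts [0 < s]. *)
have := us_W _ _ us1 us2 W1 W2; have := us_W _ _ us2 us1 W2 W1; rewrite -!leqNgt => le1 le2.
have /(congr1 (fun i => nth 0%MM us i)) : index u1 us = index u2 us by apply/eqP; rewrite eqn_leq le1 le2.
rewrite !nth_index // => /(congr1 (fun m : 'X_{1..n} => m a)).
by rewrite !mulmnE !mnmDE !mnm1E !dist !dist' mul1n => Es; rewrite Es in s_gt0.
Qed.

(** * The expansion and the substitution y := x *)

Section Expansion.

Variables (n : nat) (e : rel 'I_n) (x : 'I_n).
Hypotheses (sym_e : ssrbool.symmetric e) (irr_e : irreflexive e).

Let e' := expansion e x.
Let x' := lift ord_max x : 'I_n.+1.
Let y := ord_max : 'I_n.+1.

(* Substituting x for the new variable y. *)
Definition merge (a : 'I_n.+1) : 'I_n := odflt x (unlift ord_max a).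

Definition merge_mon (u : 'X_{1..n.+1}) : 'X_{1..n} :=
  [multinom pdeg [pred a | merge a == i] u | i < n].

Lemma merge_lift j : merge (lift ord_max j) = j.
Proof. by rewrite /merge liftK. Qed.

Lemma merge_max : merge ord_max = x.
Proof. by rewrite /merge unlift_none. Qed.

(** Pulling back adjacency along [merge] misses only the edge xy, since [e] has no loop at [x]; the
    second disjunct restores it. *)
Lemma expansionE a b :
  expansion e x a b = e (merge a) (merge b) || [&& a != b, merge a == x & merge b == x].
Proof.
rewrite /expansion /merge; case: (unliftP ord_max a) => [i|] ->;
  case: (unliftP ord_max b) => [j|] -> /=.
- rewrite (inj_eq (@lift_inj _ ord_max)); case: (eqVneq i x) => [->|]; rewrite ?andbF ?orbF //.
  by case: (eqVneq j x) => [->|]; rewrite ?eqxx ?andbF ?orbF.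
- by rewrite [lift _ _ == _]eq_sym neq_lift eqxx andbT /= sym_e.
- by rewrite neq_lift eqxx.
- by rewrite eqxx irr_e.
Qed.

Lemma simple_expansion : simple_graph (expansion e x).
Proof.
split=> [a b|a]; last by rewrite expansionE irr_e eqxx.
by rewrite !expansionE sym_e eq_sym [(merge a == x) && _]andbC.
Qed.

Lemma merge_eqx a : merge a = x -> a = x' \/ a = y.
Proof.
rewrite /merge; case: (unliftP ord_max a) => [j|] -> /=; last by right.
by move=> ->; left.
Qed.

Lemma merge_monD u v : merge_mon (u + v)%MM = (merge_mon u + merge_mon v)%MM.
Proof. by apply/mnmP=> i; rewrite mnmDE !mnmE pdegD. Qed.

Lemma merge_mon0 : merge_mon 0%MM = 0%MM.
Proof. by apply/mnmP=> i; rewrite !mnmE pdeg0. Qed.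

Lemma merge_mon1 a : merge_mon U_(a)%MM = U_(merge a)%MM.
Proof. by apply/mnmP=> i; rewrite mnmE pdeg1 mnm1E. Qed.

Lemma merge_mon_split1 u i m : merge_mon u = (U_(i) + m)%MM ->
  exists a u', [/\ merge a = i, u = (U_(a) + u')%MM & merge_mon u' = m].
Proof.
move=> Eu; have: pdeg [pred a | merge a == i] 0%MM < pdeg [pred a | merge a == i] u.
  by have /mnmP/(_ i) := Eu; rewrite mnmE mnmDE mnm1E eqxx pdeg0 => ->.
case/pdeg_lt_ex=> a /eqP Ea; rewrite mnm0E lt0n -lep1mP => le_a.
have Eu' : u = (U_(a) + (u - U_(a)))%MM by rewrite addmC submK.
exists a, (u - U_(a))%MM; split=> //; apply: (@addmI _ U_(i)%MM).
by rewrite -Eu {2}Eu' merge_monD merge_mon1 Ea.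
Qed.

(** The variables of [m1] are peeled off one by one, each lifted to a variable over it that divides
    [u]. *)
Lemma merge_mon_split u m1 m2 : merge_mon u = (m1 + m2)%MM ->
  exists u1 u2, [/\ u = (u1 + u2)%MM, merge_mon u1 = m1 & merge_mon u2 = m2].
Proof.
have [d] := ubnP (mdeg m1); elim: d u m1 => // d IHd u m1 le_d Eu.
case: (pickP (fun i => m1 i != 0)) => [i mi|m1_0]; last first.
  have E1 : m1 = 0%MM by apply/mnmP=> i; rewrite mnm0E; apply/eqP/negbFE/m1_0.
  by exists 0%MM, u; rewrite Eu E1 !add0m merge_mon0.
have Em : m1 = (U_(i) + (m1 - U_(i)))%MM by rewrite addmC submK // lep1mP.
rewrite Em -addmA in Eu; have [a [u' [Ea -> Eu']]] := merge_mon_split1 Eu.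
have [|u1 [u2 [-> Eu1 Eu2]]] := IHd u' _ _ Eu'.
  by move: le_d; rewrite {1}Em mdegD mdeg1.
by exists (U_(a) + u1)%MM, u2; split; rewrite ?addmA // merge_monD merge_mon1 Ea Eu1 -Em.
Qed.

(** Any variables over the two ends of an edge of G are adjacent in the expansion, so a
    factorisation of the image lifts whichever preimages occur in [u]. *)
Lemma edge_prod_unmerge s u :
  edge_prod e s (merge_mon u) -> edge_prod e' s u.
Proof.
move Em: (merge_mon u) => m ep_m; elim: ep_m u Em => [|{m}{}s i j m e_ij _ IHm] u Em.
  suff -> : u = 0%MM by constructor.
  apply/mnmP=> a; rewrite mnm0E; apply/eqP; have /mnmP/(_ (merge a)) := Em.
  by rewrite mnmE mnm0E /pdeg (bigD1 a) //= => /eqP; rewrite addn_eq0 => /andP[].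
rewrite -addmA in Em; have [a [u1 [Ea -> Eu1]]] := merge_mon_split1 Em.
have [b [u2 [Eb -> /IHm]]] := merge_mon_split1 Eu1.
by rewrite addmA; constructor=> //; rewrite /e' expansionE Ea Eb e_ij.
Qed.

(** [nbr] is N(x) seen in the expansion and contains neither x nor y. [f] has the edges other than
    xy; [g] has those with exactly one end in N(x), with that end first. *)
Let nbr : pred 'I_n.+1 := fun a => e x (merge a).
Let f : rel 'I_n.+1 := fun a b => e (merge a) (merge b).
Let g : rel 'I_n.+1 := fun a b => [&& f a b, nbr a & ~~ nbr b].
Let xy : 'X_{1..n.+1} := (U_(x') + U_(y))%MM.

Lemma edge_prod_merge s u : edge_prod f s u -> edge_prod e s (merge_mon u).
Proof.
elim=> [|{u}{}s a b u f_ab _ IH]; first by rewrite merge_mon0; constructor.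
by rewrite !merge_monD !merge_mon1; constructor.
Qed.

Lemma pdeg_nbr u : pdeg nbr u = pdeg (e x) (merge_mon u).
Proof.
rewrite /pdeg (partition_big merge (e x)) //=; apply: eq_bigr => i xi.
rewrite mnmE; apply: eq_bigl => a /=; rewrite /nbr.
by case: (eqVneq (merge a) i) => [->|]; rewrite ?xi ?andbF.
Qed.

(** * Generators of the expansion when N(x) meets every edge *)

Hypothesis cover : forall i j, e i j -> e x i || e x j.

Lemma nbr_edge_split s u : edge_prod f s u ->
  edge_prod g s u \/ exists p q s' u', [/\ s = s'.+1, u = (U_(p) + U_(q) + u')%MM,
    edge_prod f s' u', nbr p & nbr q].
Proof.
elim=> [|{u}{}s a b u f_ab ep_u IH]; first by left; constructor.
have [/andP[na nb]|not_nn] := boolP (nbr a && nbr b).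
  by right; exists a, b, s, u.
case: IH => [ep_gu|[p [q [s' [u' [-> -> ep_u' np nq]]]]]]; last first.
  right; exists p, q, s'.+1, (U_(a) + U_(b) + u')%MM; split=> //; last by constructor.
  by apply/mnmP=> i; rewrite !mnmDE; lia.
left; have := cover f_ab; rewrite -/(nbr a) -/(nbr b).
case: (boolP (nbr a)) not_nn => [na /= nb _|na _ /= nb].
  by constructor=> //; apply/and3P.
by rewrite [(U_(a) + _)%MM]addmC; constructor=> //; apply/and3P; rewrite /f sym_e.
Qed.

(* [x p q y = (p x) (q y)] trades a factor xy and an edge inside N(x) for two edges
   without xy, so a product either avoids xy altogether or contains, besides xy, only
   edges with exactly one end in N(x). *)
Lemma expansion_prod_cases s u : edge_prod e' s u ->
  edge_prod f s u \/ exists j t u', [/\ s = j.+1 + t, u = (xy *+ j.+1 + u')%MM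
    & edge_prod g t u'].
Proof.
have fg a b : g a b -> f a b by case/and3P.
have mx : merge x' = x := merge_lift x; have my : merge y = x := merge_max.
have g_x a : nbr a -> g a x' 
  by move=> na; apply/and3P; split=> //; rewrite /f /nbr mx ?irr_e // sym_e.
have g_y a : nbr a -> g a y 
  by move=> na; apply/and3P; split=> //; rewrite /f /nbr my ?irr_e // sym_e.
have swap p q t v : nbr p -> nbr q -> edge_prod g t v ->
    exists2 w, edge_prod g t.+2 w & (xy + (U_(p) + U_(q) + v) = w)%MM.
  move=> np nq ep_v; exists (U_(p) + U_(x') + (U_(q) + U_(y) + v))%MM.
    by do 2?constructor; rewrite ?g_x ?g_y.
  by apply/mnmP=> i; rewrite !mnmDE; lia.
elim=> [|{u}{}s a b u]; first by left; constructor.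
rewrite /e' expansionE -/(f a b) => e_ab _ IH.
have [f_ab|not_f] := boolP (f a b); last first.
  have -> : (U_(a) + U_(b) = xy)%MM.
    move: e_ab; rewrite (negbTE not_f) /= => /and3P[ne_ab].
    move=> /eqP/merge_eqx[]Ea /eqP/merge_eqx[]Eb; rewrite Ea Eb ?eqxx // in ne_ab *.
    exact: addmC.
  case: IH => [|[j [t [u' [-> -> ep_u']]]]]; last first.
    by right; exists j.+1, t, u'; split=> //; rewrite [in RHS]mulmS addmA.
  case/nbr_edge_split=> [ep_u|[p [q [s' [u' [-> -> ep_u' np nq]]]]]].
    (* The exponent of [xy] is [j.+1], so [j = 0] means one factor [xy]. *)
    by right; exists 0, s, u.
  left; have -> : (xy + (U_(p) + U_(q) + u') =
      U_(p) + U_(x') + (U_(q) + U_(y) + u'))%MM.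
    by apply/mnmP=> i; rewrite !mnmDE; lia.
  by constructor; [apply/fg/g_x | constructor=> //; apply/fg/g_y].
case: IH => [ep_u|[j [t [u' [-> -> ep_u']]]]]; first by left; constructor.
(* An edge inside N(x) uses up one factor [xy]; if it was the last, the product is back in the first
   case. *)
have [/andP[na nb]|not_nn] := boolP (nbr a && nbr b).
  have [w ep_w Ew] := swap a b t u' na nb ep_u'.
  have Eu : (U_(a) + U_(b) + (xy *+ j.+1 + u') = xy *+ j + w)%MM.
    by rewrite -Ew mulmS; apply/mnmP=> i; rewrite !mnmDE; lia.
  rewrite Eu; case: j {Eu} => [|j].
    by left; rewrite mulm0n add0m; apply: sub_edge_prod ep_w.
  by right; exists j, t.+2, w; split=> //; lia.
right; wlog /andP[na nb] : a b f_ab {e_ab} not_nn / nbr a && ~~ nbr b => [wlg|].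
  have := cover f_ab; rewrite -/(nbr a) -/(nbr b).
  have [na nb|na /= nb] := boolP (nbr a).
    by apply: wlg; rewrite // na /=; rewrite na in not_nn.
  by rewrite [(U_(a) + _)%MM]addmC; apply: wlg; rewrite ?nb // 1?andbC // /f sym_e.
exists j, t.+1, (U_(a) + U_(b) + u')%MM; split; first by lia.
  by apply/mnmP=> i; rewrite !mnmDE; lia.
by constructor=> //; apply/and3P.
Qed.

Lemma nbr_x' : nbr x' = false. Proof. by rewrite /nbr merge_lift irr_e. Qed.
Lemma nbr_y : nbr y = false. Proof. by rewrite /nbr merge_max irr_e. Qed.

(** [xy] lies outside N(x) and each factor from [g] contributes one, so the product determines
    [t]. *)
Lemma pdeg_nbr_deficient j t u :
  edge_prod g t u -> pdeg nbr (xy *+ j + u)%MM = t.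
Proof.
rewrite pdegD pdegMn pdegD !pdeg1 nbr_x' nbr_y => ep_u; rewrite addn0 mul0n add0n.
elim: ep_u => [|{u}{}t a b u /and3P[_ na /negbTE nb] _ IH]; first exact: pdeg0.
by rewrite !pdegD !pdeg1 na nb IH.
Qed.

Lemma edge_prod_deficient j t u :
  edge_prod g t u -> edge_prod e' (j + t) (xy *+ j + u)%MM.
Proof.
move=> ep_u; apply: edge_prodD.
  apply: edge_prodMn; rewrite /e' expansionE merge_lift merge_max eqxx.
  by rewrite eq_sym neq_lift orbT.
by apply: sub_edge_prod ep_u => a b /and3P[f_ab _ _]; rewrite /e' expansionE -/(f a b) f_ab.
Qed.

(** One factor [xy] becomes the edge [zy]. The N(x)-degree rises, which moves the product forward in
    the order. *)
Lemma nbr_step j t u z : edge_prod g t u -> nbr z ->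
  let u0 := (xy *+ j.+1 + u)%MM in
  exists u'', [/\ edge_prod e' (j.+1 + t) u'', pdeg nbr u'' = t.+1
    & (u'' <= u0 + U_(z))%MM].
Proof.
move=> ep_u nz; exists (U_(z) + U_(y) + (xy *+ j + u))%MM; split.
- rewrite addSn; constructor; last exact: edge_prod_deficient.
  by rewrite /e' expansionE merge_max sym_e -/(nbr z) nz.
- by rewrite pdegD (pdeg_nbr_deficient _ ep_u) pdegD !pdeg1 nz nbr_y.
- by rewrite mulmS; apply/mnm_lepP => i; rewrite !mnmDE; lia.
Qed.

(** Agreement on N(x) lets the factors be permuted until their ends in N(x) coincide. The other ends
    are then choices from the same sets [g (p k)], and the transversal exchange applies. *)
Lemma deficient_exchange t u u' i :
  edge_prod g t u -> edge_prod g t u' -> (forall a, nbr a -> u a = u' a) ->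
  u i < u' i -> exists k, exists2 v, edge_prod g t v &
    u' k < u k /\ (v + U_(k) = u + U_(i))%MM.
Proof.
case/edge_prod_sumP=> p [q [g_pq ->]] /edge_prod_sumP[p' [q' [g_pq' ->]]] Enbr.
have sum0 (P : pred 'I_n.+1) (r : 'I_t -> 'I_n.+1) a :
    (forall k, P (r k)) -> ~~ P a -> (\sum_k U_(r k))%MM a = 0.
  move=> Pr Pa; rewrite mnm_sumE big1 // => k _; rewrite mnm1E.
  by case: eqP => // Ea; rewrite -Ea Pr in Pa.
have np k : nbr (p k) by case/and3P: (g_pq k).
have np' k : nbr (p' k) by case/and3P: (g_pq' k).
have nq k : ~~ nbr (q k) by case/and3P: (g_pq k).
have nq' k : ~~ nbr (q' k) by case/and3P: (g_pq' k).
have Ep : (\sum_k U_(p k) = \sum_k U_(p' k))%MM.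
  apply/mnmP=> a; have [na|na] := boolP (nbr a); last by rewrite !(sum0 nbr).
  have := Enbr a na; rewrite !big_split !mnmDE.
  by rewrite (sum0 (predC nbr) q) ?(sum0 (predC nbr) q') /= ?negbK ?addn0.
have [s' Es'] := sum_mnm1_perm Ep.
have Eq' : (\sum_k U_(q' k) = \sum_k U_(q' (s' k)))%MM.
  by rewrite (reindex_inj (@perm_inj _ s')).
rewrite !big_split Ep Eq' !mnmDE ltn_add2l /= => lt_i.
have [|k'|k [h Rh [lt_k Eh]]] := @transversal_exchange _ _ (fun k => g (p k)) _ _ i _ _ lt_i.
- by [].
- by rewrite -Es'.
exists k, (\sum_k (U_(p k) + U_(h k)))%MM; first by apply/edge_prod_sumP; exists p, h.
by rewrite !mnmDE ltn_add2l -addmA -Eh big_split Ep /= addmA.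
Qed.

(** * The ordering of the generators and its linear quotients *)

(** Positions in [us] stay below [size us], so the second kind follows; for it [s - pdeg nbr u] is
    the power of [xy] split off. *)
Definition expansion_rank (us : seq 'X_{1..n}) s (u : 'X_{1..n.+1}) : nat :=
  if merge_mon u \in us then index (merge_mon u) us
  else size us + (s - pdeg nbr u).

(** In a tie the larger monomial comes first, hence [u < u'] for [u'] preceding [u]. *)
Definition expansion_lt us s : rel 'X_{1..n.+1} := fun u' u =>
  (expansion_rank us s u' < expansion_rank us s u)
  || (expansion_rank us s u' == expansion_rank us s u) && (u < u')%O.

Lemma expansion_lt_irr us s : irreflexive (expansion_lt us s).
Proof. by move=> u; rewrite /expansion_lt ltnn Order.POrderTheory.ltxx andbF. Qed.

Lemma expansion_lt_trans us s : transitive (expansion_lt us s).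
Proof.
rewrite /expansion_lt => v u w.
case: ltngtP => //= [lt_uv _|Euv lt_vu]; case: ltngtP => //= [lt_vw _|Evw lt_wv].
- by rewrite (ltn_trans lt_uv lt_vw).
- by rewrite -Evw lt_uv.
- by rewrite Euv lt_vw.
- by rewrite Euv Evw ltnn eqxx (Order.POrderTheory.lt_trans lt_wv lt_vu).
Qed.

Lemma expansion_lt_total us s u v :
  u != v -> expansion_lt us s u v || expansion_lt us s v u.
Proof.
by rewrite /expansion_lt; case: ltngtP => //= _; rewrite Order.TotalTheory.neq_lt orbC.
Qed.

(** Trading [k] for the smaller index [i] raises the first exponent that changes, and the degree is
    kept. *)
Lemma first_difference (u v : 'X_{1..n.+1}) i k :
  (v + U_(k) = u + U_(i))%MM -> i < k -> (u < v)%O.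
Proof.
move=> Ev lt_ik; have /mnmP Ev' := Ev; have neq_ik : i != k by rewrite neq_ltn lt_ik.
apply/ltmcP; first by have /(congr1 mdeg) := Ev; rewrite !mdegD !mdeg1; lia.
exists i => [j lt_ji|]; have := Ev' _; last first.
  by move=> /(_ i); rewrite !mnmDE !mnm1E eqxx eq_sym (negbTE neq_ik); lia.
move=> /(_ j); rewrite !mnmDE !mnm1E; case: eqP => [Ek|_]; first by rewrite -Ek in lt_ji; lia.
by case: eqP => [Ei|_]; [rewrite Ei ltnn in lt_ji | rewrite !addn0 => ->].
Qed.

Lemma expansion_lq_rel us s :
  us =i pow_mons (edge_mons e) s -> lq_rel us (relpre (index^~ us) ltn) ->
  lq_rel (pow_mons (edge_mons e') s) (expansion_lt us s).
Proof.
move=> us_ms lq_us.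
have usP m : m \in us <-> edge_prod e s m by rewrite us_ms; apply: mem_pow_mons.
have msP u : u \in pow_mons (edge_mons e') s <-> edge_prod e' s u.
  by apply: mem_pow_mons; apply: simple_expansion.
have deficient u : edge_prod e' s u -> merge_mon u \notin us ->
    exists j t u', [/\ s = j.+1 + t, u = (xy *+ j.+1 + u')%MM & edge_prod g t u'].
  by move=> ep_u; case: (expansion_prod_cases ep_u) => // /edge_prod_merge/usP->.
have rank_lt u : merge_mon u \in us -> expansion_rank us s u < size us.
  by move=> us_u; rewrite /expansion_rank us_u index_mem.
have pdeg_us u : merge_mon u \in us -> s <= pdeg nbr u.
  by move/usP/(pdeg_edge_prod_ge cover); rewrite -pdeg_nbr.
move=> u u' /msP ep_u /msP ep_u' lt_u'u.
have Edeg : mdeg u = mdeg u' by rewrite (mdeg_edge_prod ep_u) (mdeg_edge_prod ep_u').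
have [us_u|nus_u] := boolP (merge_mon u \in us).
  have us_u' : merge_mon u' \in us.
    apply: contraLR lt_u'u => nus_u'; have := rank_lt _ us_u.
    have : size us <= expansion_rank us s u'.
      by rewrite /expansion_rank (negbTE nus_u') leq_addr.
    by move=> le1 lt2; apply/negP => /orP[|/andP[/eqP+ _]]; lia.
  case/orP: lt_u'u => [|/andP[]]; rewrite /expansion_rank us_u us_u'.
    (* For different images, the exchange in G is lifted: [z] lies over [i], and the factor [m] of
       the image lifts to a factor [u1] of [u z]. *)
    move=> lt_u'u; have [i [m us_m [lt_i lt_m le_m]]] := lq_us _ _ us_u us_u' lt_u'u.
    rewrite !mnmE in lt_i; have [z /eqP Ez lt_z] := pdeg_lt_ex lt_i.
    have Em : merge_mon (u + U_(z))%MM = (m + (merge_mon u + U_(i) - m))%MM.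
      by rewrite merge_monD merge_mon1 Ez [RHS]addmC submK.
    have [u1 [u2 [Eu Eu1 _]]] := merge_mon_split Em.
    exists z, u1.
      by apply/msP/edge_prod_unmerge; rewrite Eu1; apply/usP.
    split=> //; last by rewrite Eu lem_addr.
    by rewrite /expansion_lt /expansion_rank Eu1 us_m us_u; apply/orP; left.
  (* With equal images, [u] and [u'] differ only in how the exponent of x is shared between x and y.
     Moving one unit keeps the image. *)
  move=> /eqP Eidx lt_uu'.
  have Em : merge_mon u' = merge_mon u.
    by rewrite -(nth_index 0%MM us_u') Eidx nth_index.
  have [i eq_i lt_i] := elimT (ltmcP Edeg) lt_uu'.
  have [w /eqP Ew lt_w] : exists2 w, merge w == merge i & u' w < u w.
    case: (pickP [pred w | (merge w == merge i) && (u' w < u w)]) => [w /andP[]|no].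
      by exists w.
    have /mnmP/(_ (merge i)) := Em; rewrite !mnmE => Epd.
    suff : pdeg [pred a | merge a == merge i] u < pdeg [pred a | merge a == merge i] u'.
      by rewrite Epd ltnn.
    rewrite /pdeg (bigD1 i) //= [X in _ < X](bigD1 i) //= -addSn leq_add //.
    by apply: leq_sum => w /andP[Ew _]; have := no w; rewrite /= Ew /=; lia.
  have lt_iw : i < w.
    case: (ltngtP i w) => // [lt_wi|/val_inj Eiw]; last by rewrite -Eiw in lt_w; lia.
    by have := eq_i w lt_wi; lia.
  have le_w : (U_(w) <= u + U_(i))%MM by rewrite lep1mP mnmDE; lia.
  have Eu'' : (u + U_(i) - U_(w) + U_(w) = u + U_(i))%MM by rewrite submK.
  have Em'' : merge_mon (u + U_(i) - U_(w))%MM = merge_mon u.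
    by apply: (@addIm _ U_(merge i)%MM); rewrite -{1}Ew -!merge_mon1 -!merge_monD Eu''.
  exists i, (u + U_(i) - U_(w))%MM.
    by apply/msP/edge_prod_unmerge; rewrite Em''; apply/usP.
  split=> //; last exact: lem_subr.
  by rewrite /expansion_lt /expansion_rank Em'' us_u eqxx (first_difference Eu'') ?orbT.
have [j [t [v [Es Eu ep_v]]]] := deficient u ep_u nus_u.
have deg_u : pdeg nbr u = t by rewrite Eu (pdeg_nbr_deficient _ ep_v).
have rank_u : expansion_rank us s u = size us + (s - t).
  by rewrite /expansion_rank (negbTE nus_u) deg_u.
have rank_le u'' : t <= pdeg nbr u'' ->
    expansion_rank us s u'' <= expansion_rank us s u.
  rewrite rank_u => le_t; have [/rank_lt|nus] := boolP (merge_mon u'' \in us); first by lia.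
  by rewrite /expansion_rank (negbTE nus) leq_add2l leq_sub2l.
(* If [u'] exceeds [u] at a variable of N(x), that variable serves. *)
have [/existsP[z /andP[nz lt_z]]|no_nbr] := boolP [exists z, nbr z && (u z < u' z)].
  have [u'' [ep_u'' deg_u'' le_u'']] := nbr_step j ep_v nz.
  exists z, u''; first by apply/msP; rewrite Es.
  rewrite Eu; split=> //; rewrite -?Eu //.
  rewrite /expansion_lt rank_u; apply/orP; left.
  have [/rank_lt|nus] := boolP (merge_mon u'' \in us); first by lia.
  by rewrite /expansion_rank (negbTE nus) deg_u'' ltn_add2l; lia.
(* Otherwise [u'] has N(x)-degree at most [t < s], so it is of the second kind; coming earlier, it
   can only tie with [u] in rank, and the two agree on N(x). *)
have le_nbr a : nbr a -> u' a <= u a.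
  move=> na; have := no_nbr; rewrite negb_exists => /forallP/(_ a).
  by rewrite na /= -leqNgt.
have le_deg : pdeg nbr u' <= t by rewrite -deg_u; apply: leq_pdeg.
have nus_u' : merge_mon u' \notin us.
  by apply/negP => /pdeg_us; lia.
have [j' [t' [v' [Es' Eu' ep_v']]]] := deficient u' ep_u' nus_u'.
have deg_u' : pdeg nbr u' = t' by rewrite Eu' (pdeg_nbr_deficient _ ep_v').
have rank_u' : expansion_rank us s u' = size us + (s - t').
  by rewrite /expansion_rank (negbTE nus_u') deg_u'.
have {}lt_u'u : t' = t /\ (u < u')%O.
  by case/orP: lt_u'u; rewrite rank_u rank_u'; [|move=> /andP[/eqP]]; lia.
case: lt_u'u => Et lt_uu'; have Ej : j' = j by lia.
rewrite Et Ej in Eu' ep_v'.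
have eq_nbr a : nbr a -> v a = v' a.
  move=> na; suff : u' a = u a by rewrite Eu Eu' !mnmDE; lia.
  apply/eqP; rewrite eqn_leq le_nbr //= leqNgt; apply/negP => lt_a.
  suff : pdeg nbr u' < pdeg nbr u by lia.
  rewrite /pdeg (bigD1 a) //= [X in _ < X](bigD1 a) //= -addSn leq_add //.
  by apply: leq_sum => b /andP[nb _]; apply: le_nbr.
have [i eq_i lt_i] := elimT (ltmcP Edeg) lt_uu'.
have lt_vi : v i < v' i by move: lt_i; rewrite Eu Eu' !mnmDE ltn_add2l.
have [k [v'' ep_v'' [lt_k Ev'']]] := deficient_exchange ep_v ep_v' eq_nbr lt_vi.
have Eu'' : (xy *+ j.+1 + v'' + U_(k) = u + U_(i))%MM by rewrite -addmA Ev'' addmA -Eu.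
have lt_ik : i < k.
  have lt_uk : u' k < u k by rewrite Eu Eu' !mnmDE ltn_add2l.
  case: (ltngtP i k) => // [lt_ki|/val_inj Eik]; last by rewrite -Eik in lt_uk; lia.
  by have := eq_i k lt_ki; lia.
exists i, (xy *+ j.+1 + v'')%MM; first by apply/msP; rewrite Es; apply: edge_prod_deficient.
split=> //; last by rewrite -Eu'' lem_addr.
(* The new product may be of the first kind, with smaller rank; the inequality of ranks covers both
   cases. *)
rewrite /expansion_lt (first_difference Eu'') // andbT orbC -leq_eqVlt.
by apply: rank_le; rewrite (pdeg_nbr_deficient _ ep_v'').
Qed.

End Expansion.

(** * From a gapfree expansion to the equivalence *)

(** When x is not an end of ij, gapfreeness for xy and ij gives an edge from x or y to i or j, and
    merging y into x makes it an edge of G at x. *)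
Lemma gapfree_expansion_cover (n : nat) (e : rel 'I_n) (x i j : 'I_n) :
  simple_graph e -> gapfree (expansion e x) -> e i j -> e x i || e x j.
Proof.
move=> [sym_e irr_e] gap e_ij.
have [Ei|ne_i] := eqVneq i x; first by rewrite -{2}Ei e_ij orbT.
have [Ej|ne_j] := eqVneq j x; first by rewrite -{1}Ej sym_e e_ij.
have := gap (lift ord_max x) ord_max (lift ord_max i) (lift ord_max j).
rewrite !expansionE // !merge_lift merge_max !eqxx eq_sym neq_lift orbT e_ij.
rewrite !(inj_eq (@lift_inj _ _)) !(eq_sym x) ne_i ne_j !neq_lift.
case=> // a [b []]; rewrite expansionE //.
move=> e_ab; rewrite -!orbA => Xab IJab.
have {}Xab : merge x a = x \/ merge x b = x.
  by case/or4P: Xab => /eqP->; rewrite ?merge_lift ?merge_max; auto.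
have {}IJab : (merge x a = i \/ merge x a = j) \/ (merge x b = i \/ merge x b = j).
  by case/or4P: IJab => /eqP->; rewrite ?merge_lift; auto.
have absurd_i : x <> i by move=> Ex; rewrite -Ex eqxx in ne_i.
have absurd_j : x <> j by move=> Ex; rewrite -Ex eqxx in ne_j.
case: Xab => E; rewrite E in e_ab IJab; case: IJab => [][] E' //; move: e_ab;
  rewrite E' ?(negbTE ne_i) ?(negbTE ne_j) !andbF orbF ?[e _ x]sym_e => -> //;
  by rewrite orbT.
Qed.

Theorem theorem3p4 (K : fieldType) (n : nat) (e : rel 'I_n) (s : nat) (x : 'I_n) :
  simple_graph e -> (1 <= s)%N ->
  linear_quotients (pow_gens (edge_gens K e) s) ->
  (linear_quotients (pow_gens (edge_gens K (expansion e x)) s)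
   <-> gapfree (expansion e x)).
Proof.
move=> se s_gt0 lq; have [sym_e irr_e] := se.
have se' := simple_expansion x sym_e irr_e.
split=> [|gap]; first exact: gapfree_of_linear_quotients.
have deg_ms k (r : rel 'I_k) : simple_graph r ->
    {in pow_mons (edge_mons r) s, forall u, mdeg u = s.*2}.
  by move=> sr u /(mem_pow_mons _ _ sr)/mdeg_edge_prod.
rewrite pow_gens_edge_gens in lq.
have [us us_ms lq_us] := lq_rel_of_linear_quotients (deg_ms _ _ se) lq.
rewrite pow_gens_edge_gens.
apply: (linear_quotients_of_lq_rel K (deg_ms _ _ se')).
- exact: (@expansion_lt_irr _ e x us s).
- exact: expansion_lt_trans.
- by move=> u v; apply: expansion_lt_total.
- apply: expansion_lq_rel => // i j; exact: gapfree_expansion_cover.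
Qed.
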